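(* Let $A$ be an octonion division algebra over a field $F$, let $\phi(z)=c_n z^n+\dots+c_1 z+c_0$ be a standard polynomial over $A$ (with $c_0,\dots,c_n\in A$), and let $\Phi(z)$ be its companion polynomial. Then the set $R(\Phi)$ is the union of the conjugacy classes of the elements of $R(\phi)$. Moreover, each such class is either fully contained in $R(\phi)$ or has exactly one representative in $R(\phi)$.
   Context: $F$ is a field of arbitrary characteristic. An octonion algebra over $F$ is an algebra $A=Q\oplus Q\ell$, where $Q$ is a quaternion algebra over $F$ with its canonical symplectic involution $\bar{\ }$, $\ell^2\in F^\times$, and multiplication is $(p+q\ell)(r+s\ell)=pr+\ell^2\bar{s}q+(sp+q\bar{r})\ell$. The involution extends to $A$ by $\overline{p+q\ell}=\overline{p}-q\ell$. The norm form $\operatorname{Norm}(x)=\overline{x}\cdot x$ and the trace form $\operatorname{Tr}(x)=x+\overline{x}$ take values in $F$. $A$ is alternative; it is a division algebra if and only if its norm form is anisotropic. Two elements $g,g'\in A$ are conjugate if there is $h\in A^\times$ with $hgh^{-1}=g'$; this is an equivalence relation, and $g,g'$ are conjugate if and only if $\operatorname{Tr}(g)=\operatorname{Tr}(g')$ and $\operatorname{Norm}(g)=\operatorname{Norm}(g')$. Its equivalence classes are the conjugacy classes. A standard polynomial over $A$ is a polynomial $\phi(z)=c_n z^n+\dots+c_1z+c_0$ with coefficients $c_i\in A$ on the left of the variable; for $\lambda\in A$, $\phi(\lambda)=c_n\lambda^n+\dots+c_1\lambda+c_0$. $R(\phi)=\{\lambda\in A:\phi(\lambda)=0\}$ is the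 set of roots of $\phi$ in $A$. The companion polynomial of $\phi$ is $\Phi(z)=b_{2n}z^{2n}+\dots+b_1z+b_0$ where, for $k\in\{0,\dots,2n\}$: if $k$ is odd, $b_k$ is the sum of all $\operatorname{Tr}(\overline{c_i}c_j)$ with $0\le i<j\le n$ and $i+j=k$; if $k=2m$ is even, $b_k$ is the sum of all $\operatorname{Tr}(\overline{c_i}c_j)$ with $0\le i<j\le n$ and $i+j=k$, plus $\operatorname{Norm}(c_m)$. The coefficients $b_k$ lie in $F$, and $R(\Phi)$ denotes the set of roots of $\Phi$ in $A$. *)

(* Defs.v *)
From HB Require Import structures.
From mathcomp Require Import all_boot all_order all_algebra all_field.
From mathcomp Require Import boolp classical_sets.
Set Implicit Arguments.
Unset Strict Implicit.
Unset Printing Implicit Defensive.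
Import GRing.Theory.
Local Open Scope ring_scope.
Local Open Scope classical_set_scope.

(* Quaternion algebras in arbitrary characteristic: Q has an F-basis
   1, i, j, ij with
     char F <> 2 :  i^2 = a,      j^2 = b,  ji = - ij       (a, b <> 0),
     char F  = 2 :  i^2 + i = a,  j^2 = b,  ji = (i + 1) j  (b <> 0). *)
Definition quaternion_basis (F : fieldType) (Q : falgType F) (i j : Q) : Prop :=
  basis_of fullv [:: 1; i; j; i * j] /\
  exists a b : F,
    [/\ b != 0, j ^+ 2 = b%:A &
        if 2 \in [pchar F] then i ^+ 2 + i = a%:A /\ j * i = (i + 1) * j
        else [/\ a != 0, i ^+ 2 = a%:A & j * i = - (i * j)]].

(* [bar] is the canonical (symplectic) involution of the quaternion algebra Q;
   as [bar] is linear it is determined by its values on the basis. In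
   characteristic 2 one has bar i = i + 1. *)
Definition canonical_involution (F : fieldType) (Q : falgType F)
    (bar : {linear Q -> Q}) : Prop :=
  exists i j : Q,
    quaternion_basis i j /\
    [/\ bar 1 = 1, bar i = (if 2 \in [pchar F] then 1 else 0) - i,
        bar j = - j & bar (i * j) = - (i * j)].

(* The pair (p, q) stands for p + q l, where l^2 = l2. *)
Definition octonion (F : fieldType) (Q : falgType F) (bar : {linear Q -> Q})
  (l2 : F) : Type := (Q * Q)%type.

HB.instance Definition _ (F : fieldType) (Q : falgType F)
    (bar : {linear Q -> Q}) (l2 : F) :=
  GRing.Lmodule.copy (octonion bar l2) (Q * Q)%type.

Section Octonion.
Variables (F : fieldType) (Q : falgType F) (bar : {linear Q -> Q}) (l2 : F).
Local Notation A := (octonion bar l2).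

Definition oct_one : A := (1, 0).

Definition oct_mul (x y : A) : A :=
  (x.1 * y.1 + l2 *: (bar y.2 * x.2), y.2 * x.1 + x.2 * bar y.1).

Definition oct_conj (x : A) : A := (bar x.1, - x.2).

(* The trace and norm take values in the copy F 1 of F inside A; they, and
   hence the coefficients of the companion polynomial, are kept as elements
   of A. *)
Definition oct_tr (x : A) : A := x + oct_conj x.

Definition oct_norm (x : A) : A := oct_mul (oct_conj x) x.

(* A is power-associative, so the bracketing is irrelevant. *)
Definition oct_exp (x : A) (k : nat) : A := iter k (oct_mul^~ x) oct_one.

Definition oct_division : Prop :=
  forall a : A, a != 0 -> bijective (oct_mul a) /\ bijective (oct_mul^~ a).

Definition conjugate (g g' : A) : Prop :=
  exists h h' : A, [/\ oct_mul h h' = oct_one, oct_mul h' h = oct_one &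
                       oct_mul (oct_mul h g) h' = g'].

Definition conj_class (g : A) : set A := [set g' | conjugate g g'].

(* A polynomial c_n z^n + ... + c_0 is given by its family of coefficients;
   c_n may vanish. *)
Definition std_eval (n : nat) (c : 'I_n.+1 -> A) (x : A) : A :=
  \sum_(i < n.+1) oct_mul (c i) (oct_exp x i).

Definition root_set (n : nat) (c : 'I_n.+1 -> A) : set A :=
  [set x | std_eval c x = 0].

Definition companion (n : nat) (c : 'I_n.+1 -> A) : 'I_(2 * n).+1 -> A :=
  fun k =>
    \sum_(i < n.+1) \sum_(j < n.+1 | (i < j)%N && (i + j == k)%N)
       oct_tr (oct_mul (oct_conj (c i)) (c j))
    + (if odd k then 0 else oct_norm (c (inord k./2))).

End Octonion.

Arguments oct_division {F Q} bar l2.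

(* Main.v *)
Require Import Defs.
From HB Require Import structures.
From mathcomp Require Import all_boot all_order all_algebra all_field.
From mathcomp Require Import boolp classical_sets.
From mathcomp Require Import ring.
Set Implicit Arguments.
Unset Strict Implicit.
Unset Printing Implicit Defensive.
Import GRing.Theory.
Local Open Scope ring_scope.
Local Open Scope classical_set_scope.

(** Write [T] and [N] for the trace and norm of the octonion algebra [A]. Every
    [x] satisfies [x ^ 2 = T x * x - N x], so [x ^ k = a_k * x + b_k] with
    scalars [a_k], [b_k] that depend only on [k], [T x] and [N x]
    ([pow_coef], [oct_expE]). As two elements are conjugate exactly when they
    have the same trace and norm ([conjugateP]), on the conjugacy class with
    trace [t] and norm [m] the polynomial [phi] agrees with the map
    [x |-> E x + G], where [E] is the sum of the [a_k c_k] and [G] the sum of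
    the [b_k c_k] ([std_evalE]). If [E = 0] this map is constant on the class,
    and otherwise it has at most one zero, since left multiplication by [E] is
    injective: this is the dichotomy.

    The coefficient of degree [k] of the companion polynomial [Phi] is the sum
    of the [conj c_i * c_j] with [i + j = k] ([companionE]). Substituting the
    reduced powers of an [x] with trace [t] and norm [m] therefore gives
    ([companion_evalE])
      [Phi x = (t N(E) + T(conj E * G)) x + (N(G) - m N(E))].
    If [E y + G = 0] with [T y = t] and [N y = m], then
    [T(conj E * G) = - t N(E)] and [N(G) = m N(E)], so [Phi x = 0].
    Conversely let [Phi x = 0]. If [E = 0], then [N(G) = 0], so [G = 0] and
    [x] itself is a root of [phi]. Otherwise the solution [y] of [E y = - G]
    satisfies [x ^ 2 - T(y) x + N(y) = 0]. If [x] is not a scalar, its monic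
    quadratic equation is unique and [y] has the trace and norm of [x]; if
    [x] is a scalar, the equation says that [N(x - y) = 0], so [y = x]
    ([companion_root]).

    The facts on [A] rest on the multiplicativity of [N] and on the law
    [conj x (x y) = N(x) y], which are checked on pairs of quaternions, and on
    the mirror law [(y x) conj x = N(x) y], which follows by conjugation. For
    conjugacy, [h = g - conj g'] satisfies [h g = g' h] when [g] and [g'] have
    the same trace and norm; when it vanishes, some other nonzero [h] does
    ([oct_intertwiner]). *)

(** * The canonical involution of a quaternion algebra *)

(** The properties of the involution that the octonion computations need:
    [bar] is an involutive anti-automorphism with scalar trace [tq] and scalar
    norm [nq], and some nonzero element is skew. *)
Record quadratic_involution (F : fieldType) (Q : falgType F)
    (bar : {linear Q -> Q}) (tq nq : Q -> F) : Prop := QuadraticInvolution {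
  qi_bar1 : bar 1 = 1;
  qi_barK : forall x, bar (bar x) = x;
  qi_barM : forall x y, bar (x * y) = bar y * bar x;
  qi_tr : forall x, x + bar x = (tq x)%:A;
  qi_norm : forall x, bar x * x = (nq x)%:A;
  qi_skew : exists2 u : Q, u != 0 & bar u = - u }.

Lemma span4_ind (F : fieldType) (Q : falgType F) (u v w z : Q) (P : Q -> Prop) :
    basis_of fullv [:: u; v; w; z] ->
    (forall x y, P x -> P y -> P (x + y)) -> (forall a x, P x -> P (a *: x)) ->
    P u -> P v -> P w -> P z -> forall x, P x.
Proof.
move=> /andP[/eqP spanE _] PD PZ Pu Pv Pw Pz x.
have : x \in <<[:: u; v; w; z]>>%VS by rewrite spanE memvf.
rewrite !span_cons span_nil addv0.
move=> /memv_addP[_ /vlineP[a ->] [_ /memv_addP[_ /vlineP[b ->]]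
        [_ /memv_addP[_ /vlineP[d ->] [_ /vlineP[e ->] ->]] ->] ->]].
by apply: (PD _ _ (PZ _ _ Pu)); apply: (PD _ _ (PZ _ _ Pv));
  apply: (PD _ _ (PZ _ _ Pw)); exact: PZ.
Qed.

(** The relations hold in the same form in every characteristic: the trace [t]
    of [i] is [1] in characteristic 2 and [0] otherwise. *)
Lemma quaternion_relations (F : fieldType) (Q : falgType F) (i j : Q) :
    quaternion_basis i j ->
  let t : F := if 2 \in [pchar F] then 1 else 0 in
  exists a b : F, [/\ b != 0, j * j = b%:A, i * i = t *: i + a%:A &
                      j * i = t *: j - i * j].
Proof.
case=> _ [a [b [b0 jj rels]]] t; exists a, b; split=> //.
- move: rels; rewrite -expr2 /t; case: ifP => [ch2 [<- _]|_ [_ -> _]].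
    by rewrite scale1r addrCA -mulr2n -scaler_nat (pcharf0 ch2) scale0r addr0.
  by rewrite scale0r add0r.
- move: rels; rewrite /t; case: ifP => [ch2 [_ ->]|_ [_ _ ->]].
    by rewrite mulrDl mul1r scale1r addrC -scaleN1r (oppr_pchar2 ch2) scale1r.
  by rewrite scale0r add0r.
Qed.

Lemma canonical_involutionP (F : fieldType) (Q : falgType F)
    (bar : {linear Q -> Q}) :
  canonical_involution bar -> exists tq nq, quadratic_involution bar tq nq.
Proof.
case=> i [j [Qij [bar1 bari barj barij]]].
have [a [b [b0 jj ii ji]]] := quaternion_relations Qij.
have {Qij} [basis_ij _] := Qij.
move: ii ji; set t : F := (if _ then 1 else 0) => ii ji.
have {}bari : bar i = t%:A - i.
  by rewrite bari /t; case: ifP; rewrite ?scale1r ?scale0r.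
have ind := span4_ind basis_ij.
(* Anti-multiplicativity passes from basis elements to all right factors. *)
have barM_gen x : (forall y, y \in [:: 1; i; j; i * j] ->
    bar (x * y) = bar y * bar x) -> forall y, bar (x * y) = bar y * bar x.
  move=> xP; apply: ind => [y z IHy IHz|e y IHy||||];
    try by apply: xP; rewrite !inE eqxx ?orbT.
    by rewrite mulrDr !linearD /= mulrDl IHy IHz.
  by rewrite -scalerAr !linearZ /= -scalerAl IHy.
(* On the left it passes to products, so the generators i and j suffice. *)
have bariM : forall y, bar (i * y) = bar y * bar i.
  apply: barM_gen => y; rewrite !inE => /or4P[] /eqP->.
  - by rewrite bar1 mulr1 mul1r.
  - rewrite ii linearD !linearZ /= bari bar1 mulrBl !mulrBr ii.
    rewrite -!scalerAl -!scalerAr !mul1r !mulr1 !scalerBr.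
    by rewrite opprB (addrC (t *: i)) addrK.
  - rewrite barij barj bari mulrBr -scalerAr mulr1 !mulNr ji scalerN opprK.
    by rewrite addrA addNr add0r.
  - rewrite mulrA ii mulrDl -!scalerAl mul1r linearD !linearZ /= barij barj.
    rewrite bari mulNr mulrBr -scalerAr mulr1 -mulrA ji mulrBr -scalerAr.
    rewrite opprB addrAC subrr add0r mulrA ii mulrDl -!scalerAl mul1r.
    by rewrite opprD !scalerN.
have barjM : forall y, bar (j * y) = bar y * bar j.
  apply: barM_gen => y; rewrite !inE => /or4P[] /eqP->.
  - by rewrite bar1 mulr1 mul1r.
  - rewrite ji linearB linearZ /= barj barij bari mulrN mulrBl -scalerAl mul1r.
    by rewrite scalerN opprB opprK addrC.
  - by rewrite jj linearZ /= bar1 barj mulrNN jj.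
  - rewrite mulrA ji mulrBl -scalerAl -mulrA jj -!scalerAr mulr1.
    rewrite linearB !linearZ /= bar1 bari barij barj mulrNN -mulrA jj.
    by rewrite -scalerAr mulr1 opprB scalerBr !scalerA mulrC addrC subrK.
have barM x y : bar (x * y) = bar y * bar x.
  move: x y; apply: ind => [x z IHx IHz y|e x IHx y|y|y|y|y] //.
  - by rewrite mulrDl !linearD /= mulrDr IHx IHz.
  - by rewrite -scalerAl !linearZ /= -scalerAr IHx.
  - by rewrite bar1 mul1r mulr1.
  - by rewrite -mulrA !(bariM, barjM) mulrA.
have barK x : bar (bar x) = x.
  move: x; apply: ind => [x z IHx IHz|e x IHx||||].
  - by rewrite !linearD /= IHx IHz.
  - by rewrite !linearZ /= IHx.
  - by rewrite !bar1.
  - by rewrite bari linearB linearZ /= bar1 bari opprB addrC subrK.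
  - by rewrite barj linearN barj opprK.
  - by rewrite barij linearN barij opprK.
have trE x : exists e : F, x + bar x = e%:A.
  move: x; apply: ind => [x z [e IHx] [f IHz]|e x [f IHx]||||].
  - by exists (e + f); rewrite linearD addrACA IHx IHz scalerDl.
  - by exists (e * f); rewrite linearZ -scalerDr IHx scalerA.
  - by exists (1 + 1); rewrite bar1 scalerDl scale1r.
  - by exists t; rewrite bari addrC subrK.
  - by exists 0; rewrite barj subrr scale0r.
  - by exists 0; rewrite barij subrr scale0r.
have norm_i : bar i * i = (- a)%:A.
  by rewrite bari mulrBl -scalerAl mul1r ii opprD addrA subrr add0r scaleNr.
have normE x : exists e : F, bar x * x = e%:A.
  move: x; apply: ind => [x z [e IHx] [f IHz]|e x [f IHx]||||].
  - have [g xz] := trE (bar x * z); exists (e + g + f).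
    rewrite barM barK in xz.
    rewrite linearD mulrDl !mulrDr IHx IHz addrA -[_ + bar x * z + _]addrA xz.
    by rewrite -!scalerDl.
  - by exists (e * e * f); rewrite linearZ -scalerAl -scalerAr IHx !scalerA.
  - by exists 1; rewrite bar1 mulr1 scale1r.
  - by exists (- a).
  - by exists (- b); rewrite barj mulNr jj scaleNr.
  - exists (a * b); rewrite barM -mulrA (mulrA (bar i)) norm_i.
    rewrite -scalerAl mul1r -scalerAr barj mulNr jj scalerN.
    by rewrite scaleNr opprK scalerA.
have [tq tqE] := choice trE; have [nq nqE] := choice normE.
exists tq, nq; split=> //; exists j => //.
apply: contra_eq_neq jj => ->; rewrite mulr0 eq_sym scaler_eq0 negb_or b0.
exact: oner_neq0.
Qed.

Section QuaternionFacts.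
Variables (F : fieldType) (Q : falgType F) (bar : {linear Q -> Q}).
Variables (tq nq : Q -> F).
Hypothesis qi : quadratic_involution bar tq nq.

Lemma scal_inj (a b : F) : a%:A = b%:A :> Q -> a = b.
Proof.
move/eqP; rewrite -subr_eq0 -scalerBl scaler_eq0 oner_eq0 orbF subr_eq0.
by move/eqP.
Qed.

Lemma qi_barE x : bar x = (tq x)%:A - x.
Proof. by rewrite -(qi_tr qi) addrC addKr. Qed.

Lemma qi_norm_r x : x * bar x = (nq x)%:A.
Proof.
rewrite -(qi_norm qi) !qi_barE mulrBl mulrBr -scalerAl -scalerAr.
by rewrite mul1r mulr1.
Qed.

Lemma qi_norm_bar x : nq (bar x) = nq x.
Proof. by apply: scal_inj; rewrite -(qi_norm qi) (qi_barK qi) qi_norm_r. Qed.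

Lemma qi_trD x y : tq (x + y) = tq x + tq y.
Proof.
by apply: scal_inj; rewrite scalerDl -!(qi_tr qi) linearD addrACA.
Qed.

Lemma qi_trZ a x : tq (a *: x) = a * tq x.
Proof.
by apply: scal_inj; rewrite -scalerA -!(qi_tr qi) linearZ scalerDr.
Qed.

Lemma qi_tr_bar x : tq (bar x) = tq x.
Proof. by apply: scal_inj; rewrite -!(qi_tr qi) (qi_barK qi) addrC. Qed.

Lemma qi_normD x y : nq (x + y) = nq x + nq y + tq (bar x * y).
Proof.
apply: scal_inj; rewrite !scalerDl -!(qi_norm qi) -(qi_tr qi).
rewrite (qi_barM qi) (qi_barK qi) linearD mulrDl !mulrDr.
by rewrite [bar y * x + _]addrC addrACA.
Qed.

Lemma qi_normZ a x : nq (a *: x) = a ^+ 2 * nq x.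
Proof.
apply: scal_inj; rewrite -scalerA -!(qi_norm qi) linearZ /=.
by rewrite -scalerAl -scalerAr scalerA expr2.
Qed.

Lemma qi_normM x y : nq (x * y) = nq x * nq y.
Proof.
apply: scal_inj; rewrite -(qi_norm qi) (qi_barM qi) mulrA -(mulrA (bar y)).
by rewrite (qi_norm qi) -scalerAr mulr1 -scalerAl (qi_norm qi) scalerA.
Qed.

(** Compare the expansions of the norms of [x + bar y] and of its conjugate. *)
Lemma qi_trC x y : tq (x * y) = tq (y * x).
Proof.
have := qi_norm_bar (x + bar y).
rewrite linearD !qi_normD !(qi_barK qi) !qi_norm_bar => /addrI ->.
by rewrite -(qi_barM qi) qi_tr_bar.
Qed.

Lemma qi_norm0 : nq 0 = 0.
Proof. by apply: scal_inj; rewrite -(qi_norm qi) mulr0 scale0r. Qed.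

Lemma qi_normN x : nq (- x) = nq x.
Proof. by rewrite -scaleN1r qi_normZ sqrrN expr1n mul1r. Qed.

Lemma qi_norm1 : nq 1 = 1.
Proof.
by apply: scal_inj; rewrite -(qi_norm qi) (qi_bar1 qi) mulr1 scale1r.
Qed.

End QuaternionFacts.

(** * Octonion multiplication *)

Section OctonionLinearity.
Variables (F : fieldType) (Q : falgType F) (bar : {linear Q -> Q}) (l2 : F).
Local Notation A := (octonion bar l2).
Implicit Types (x y z : A) (a b : F).
Local Notation "x ** y" := (oct_mul x y) (at level 40, left associativity).
Local Notation o1 := (@oct_one F Q bar l2).

Lemma octP x y : x.1 = y.1 -> x.2 = y.2 -> x = y.
Proof. by case: x y => [p q] [r s] /= -> ->. Qed.

Lemma oct_mulDl x y z : (x + y) ** z = x ** z + y ** z.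
Proof.
apply: octP => /=; first by rewrite mulrDl mulrDr scalerDr addrACA.
by rewrite mulrDr mulrDl addrACA.
Qed.

Lemma oct_mulDr x y z : x ** (y + z) = x ** y + x ** z.
Proof.
apply: octP => /=; first by rewrite linearD mulrDr mulrDl scalerDr addrACA.
by rewrite linearD mulrDr mulrDl addrACA.
Qed.

Lemma oct_mulZl a x y : (a *: x) ** y = a *: (x ** y).
Proof.
apply: octP => /=.
  by rewrite -scalerAl -scalerAr scalerDr !scalerA (mulrC l2).
by rewrite -scalerAl -scalerAr scalerDr.
Qed.

Lemma oct_mulZr a x y : x ** (a *: y) = a *: (x ** y).
Proof.
apply: octP => /=; rewrite linearZ /=.
  by rewrite -scalerAl -scalerAr scalerDr !scalerA (mulrC l2).
by rewrite -scalerAl -scalerAr scalerDr.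
Qed.

Lemma oct_mul0l x : 0 ** x = 0.
Proof. by rewrite -[0](scale0r 0) oct_mulZl !scale0r. Qed.

Lemma oct_mul0r x : x ** 0 = 0.
Proof. by rewrite -[0](scale0r 0) oct_mulZr !scale0r. Qed.

Lemma oct_mulNl x y : (- x) ** y = - (x ** y).
Proof. by rewrite -scaleN1r oct_mulZl scaleN1r. Qed.

Lemma oct_mulNr x y : x ** (- y) = - (x ** y).
Proof. by rewrite -scaleN1r oct_mulZr scaleN1r. Qed.

Lemma oct_mul_suml I (r : seq I) (P : pred I) (f : I -> A) y :
  (\sum_(i <- r | P i) f i) ** y = \sum_(i <- r | P i) f i ** y.
Proof.
exact: (big_morph (fun x => x ** y) (fun x z => oct_mulDl x z y) (oct_mul0l y)).
Qed.

Lemma oct_mul_sumr I (r : seq I) (P : pred I) (f : I -> A) y :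
  y ** (\sum_(i <- r | P i) f i) = \sum_(i <- r | P i) y ** f i.
Proof.
exact: (big_morph (oct_mul y) (oct_mulDr y) (oct_mul0r y)).
Qed.

Lemma oct_mul_1l x : o1 ** x = x.
Proof.
by apply: octP => /=; rewrite ?mul1r ?mulr1 ?mulr0 ?mul0r ?scaler0 ?addr0.
Qed.

Lemma oct_conjD x y : oct_conj (x + y) = oct_conj x + oct_conj y.
Proof. by apply: octP => /=; rewrite ?linearD // opprD. Qed.

Lemma oct_conjZ a x : oct_conj (a *: x) = a *: oct_conj x.
Proof. by apply: octP => /=; rewrite ?linearZ // scalerN. Qed.

End OctonionLinearity.

Section OctonionFacts.
Variables (F : fieldType) (Q : falgType F) (bar : {linear Q -> Q}) (l2 : F).
Variables (tq nq : Q -> F).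
Hypothesis qi : quadratic_involution bar tq nq.
Local Notation A := (octonion bar l2).
Implicit Types (x y z g h : A) (a b : F).
Local Notation "x ** y" := (oct_mul x y) (at level 40, left associativity).
Local Notation o1 := (@oct_one F Q bar l2).
Local Notation "x ^*" := (oct_conj x) : ring_scope.

(** Trace and norm as elements of [F]; [oct_trE] and [oct_norm_l] identify
    them with the scalar octonions [x + conj x] and [conj x * x]. *)
Definition tr_scalar x : F := tq x.1.
Definition norm_scalar x : F := nq x.1 - l2 * nq x.2.
Local Notation T := tr_scalar.
Local Notation N := norm_scalar.

Lemma oct_mul_1r x : x ** o1 = x.
Proof.
apply: octP => /=; rewrite ?linear0 ?mulr1 ?mul0r ?scaler0 ?addr0 //.
by rewrite (qi_bar1 qi) mulr1 add0r.
Qed.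

Lemma oct_conjK x : x^*^* = x.
Proof. by apply: octP => /=; rewrite ?(qi_barK qi) ?opprK. Qed.

Lemma oct_conjM x y : (x ** y)^* = y^* ** x^*.
Proof.
apply: octP => /=.
  rewrite linearD linearZ /= !(qi_barM qi) (qi_barK qi) linearN /=.
  by rewrite mulrNN.
by rewrite (qi_barK qi) !mulNr opprD addrC.
Qed.

Lemma oct_trE x : x + x^* = T x *: o1.
Proof. by apply: octP => /=; rewrite ?(qi_tr qi) // subrr scaler0. Qed.

Lemma oct_conjE x : x^* = T x *: o1 - x.
Proof. by rewrite -oct_trE addrC addKr. Qed.

(** The left inverse property, which replaces associativity below. *)
Lemma oct_mulKl x y : x^* ** (x ** y) = N x *: y.
Proof.
case: x y => [p q] [r s]; apply: octP => /=.
  rewrite linearD !(qi_barM qi) (qi_barK qi) mulrN !mulrDr !mulrDl.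
  rewrite -!scalerAr !mulrA (qi_norm qi) -scalerAl mul1r.
  rewrite -!mulrA (qi_norm qi) -scalerAr mulr1 !mulrA.
  rewrite scalerN scalerDr opprD addrA addrK.
  by rewrite scalerA -scalerBl.
rewrite linearD linearZ /= !(qi_barM qi) (qi_barK qi) mulrDl mulNr mulrDr.
rewrite opprD -(mulrA s) (qi_norm_r qi) -scalerAr mulr1 mulrA addrA addrK.
rewrite -scalerAr mulrA (qi_norm_r qi) -scalerAl mul1r.
by rewrite scalerA -scalerBl.
Qed.

Lemma oct_norm_l x : x^* ** x = N x *: o1.
Proof. by rewrite -{2}[x]oct_mul_1r oct_mulKl. Qed.

Lemma norm_conj x : N x^* = N x.
Proof. by rewrite /N /= (qi_norm_bar qi) (qi_normN qi). Qed.

Lemma oct_mulKr x y : (y ** x) ** x^* = N x *: y.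
Proof.
have := oct_mulKl x^* y^*.
by rewrite -oct_conjM -oct_conjM -oct_conjZ norm_conj => /(can_inj oct_conjK).
Qed.

Lemma oct_norm_r x : x ** x^* = N x *: o1.
Proof. by rewrite -norm_conj -oct_norm_l oct_conjK. Qed.

Lemma oct_sqr x : x ** x = T x *: x - N x *: o1.
Proof.
by rewrite -oct_norm_l oct_conjE oct_mulDl oct_mulZl oct_mul_1l oct_mulNl subKr.
Qed.

Lemma tr_scalarC x y : T (x ** y) = T (y ** x).
Proof.
rewrite /T /= !(qi_trD qi) !(qi_trZ qi) (qi_trC qi); congr (_ + _ * _).
by rewrite -[LHS](qi_tr_bar qi) (qi_barM qi) (qi_barK qi).
Qed.

Lemma tr_scalarZ a x : T (a *: x) = a * T x. Proof. exact: (qi_trZ qi). Qed.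
Lemma tr_scalar_conj x : T x^* = T x. Proof. exact: (qi_tr_bar qi). Qed.

Lemma norm_scalarM x y : N (x ** y) = N x * N y.
Proof.
case: x y => [p q] [r s]; rewrite /N /= !(qi_normD qi) (qi_normZ qi).
rewrite !(qi_normM qi) !(qi_norm_bar qi) -scalerAr (qi_trZ qi).
rewrite !(qi_barM qi) -!mulrA (qi_trC qi (bar r)) -!mulrA; ring.
Qed.

Lemma norm_scalarZ a x : N (a *: x) = a ^+ 2 * N x.
Proof. by rewrite /N /= !(qi_normZ qi); ring. Qed.

Lemma norm_scalar1 : N o1 = 1.
Proof. by rewrite /N /= (qi_norm0 qi) (qi_norm1 qi) mulr0 subr0. Qed.

Lemma tr_scalar1 : T o1 = 1 + 1.
Proof.
apply: (@scal_inj _ Q).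
by rewrite /T -(qi_tr qi) /= (qi_bar1 qi) scalerDl scale1r.
Qed.

Lemma scal_one_inj a b : a *: o1 = b *: o1 -> a = b.
Proof. by case=> /scal_inj. Qed.

Lemma norm_scalarD x y : N (x + y) = N x + N y + T (x^* ** y).
Proof.
apply: scal_one_inj; rewrite [in RHS]scalerDl [in RHS]scalerDl.
rewrite -!oct_norm_l -oct_trE oct_conjM oct_conjK.
by rewrite oct_conjD oct_mulDl !oct_mulDr [y^* ** x + _]addrC addrACA.
Qed.

End OctonionFacts.

(** * Powers and antidiagonal sums *)

Section PowerCoefficients.
Variables (F : fieldType) (t n : F).

(** The pair [(a, b)] with [x ^ k = a * x + b] whenever
    [x ^ 2 = t * x - n]. *)
Definition pow_coef (k : nat) : F * F :=
  iter k (fun ab => (t * ab.1 + ab.2, - (n * ab.1))) (0, 1).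

(** The product of [x ^ i] and [x ^ j], reduced modulo [x ^ 2 = t * x - n]. *)
Lemma pow_coefD i j :
  pow_coef (i + j) =
    (t * (pow_coef i).1 * (pow_coef j).1 + (pow_coef i).1 * (pow_coef j).2
       + (pow_coef i).2 * (pow_coef j).1,
     (pow_coef i).2 * (pow_coef j).2 - n * (pow_coef i).1 * (pow_coef j).1).
Proof.
elim: j => [|j IH].
  by rewrite addn0; case: (pow_coef i) => a b /=; congr pair; ring.
rewrite addnS {1}/pow_coef iterS -/(pow_coef _) IH /= -/(pow_coef j).
by congr pair; ring.
Qed.

End PowerCoefficients.

(** A sum over [i + j = k], grouped into pairs [i < j] and the diagonal term
    present for even [k]. *)
Lemma sum_antidiagonal (V : zmodType) (n : nat) (k : 'I_(2 * n).+1)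
    (X : 'I_n.+1 -> 'I_n.+1 -> V) :
  \sum_(i < n.+1) \sum_(j < n.+1 | (i < j)%N && (i + j == k)%N) (X i j + X j i)
    + (if odd k then 0 else X (inord k./2) (inord k./2)) =
  \sum_(i < n.+1) \sum_(j < n.+1 | (i + j == k)%N) X i j.
Proof.
have diagE : \sum_(i < n.+1) (if (i + i == k)%N then X i i else 0) =
    if odd k then 0 else X (inord k./2) (inord k./2).
  case: ifP => [k_odd|k_even].
    apply: big1 => i _; case: eqP => // ik.
    by move: k_odd; rewrite -ik addnn odd_double.
  have kk : (k./2 + k./2 = k)%N by rewrite addnn halfK k_even subn0.
  have k_lt : (k./2 < n.+1)%N.
    by rewrite ltnS -leq_double -addnn kk -mul2n -ltnS.
  rewrite (bigD1 (inord k./2)) //= inordK // kk eqxx big1 ?addr0 // => i ne_i.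
  case: eqP => // ik; case/eqP: ne_i; apply: val_inj; rewrite /= inordK //.
  by rewrite -ik addnn doubleK.
rewrite -diagE.
under eq_bigr do rewrite big_split /=.
rewrite big_split /= [X in _ + X + _](exchange_big_dep predT) //=.
rewrite -!big_split /=; apply: eq_bigr => i _.
rewrite [RHS](bigID (fun j : 'I_n.+1 => (i < j)%N)) /= -addrA; congr (_ + _).
  by apply: eq_bigl => j; rewrite andbC.
rewrite [RHS](bigID (fun j : 'I_n.+1 => (j < i)%N)) /=; congr (_ + _).
  apply: eq_bigl => j; rewrite addnC andbC.
  by case: (ltngtP i j); rewrite ?andbF ?andbT.
rewrite (eq_bigl (fun j => (j == i) && (i + i == k)%N)) => [|j].
  by rewrite big_andbC; case: ifP => _; rewrite ?big_pred1_eq ?big_pred0.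
rewrite -andbA -!leqNgt -eqn_leq -val_eqE /= andbC; by case: eqP => // ->.
Qed.

(** * Conjugacy in an octonion division algebra *)

Section DivisionOctonions.
Variables (F : fieldType) (Q : falgType F) (bar : {linear Q -> Q}) (l2 : F).
Variables (tq nq : Q -> F).
Hypothesis qi : quadratic_involution bar tq nq.
Hypothesis hdiv : oct_division bar l2.
Local Notation A := (octonion bar l2).
Implicit Types (x y z g h : A) (a b : F).
Local Notation "x ** y" := (oct_mul x y) (at level 40, left associativity).
Local Notation o1 := (@oct_one F Q bar l2).
Local Notation "x ^*" := (oct_conj x) : ring_scope.
Local Notation T := (@tr_scalar F Q bar l2 tq).
Local Notation N := (@norm_scalar F Q bar l2 nq).

Lemma norm_scalar_eq0 x : N x = 0 -> x = 0.
Proof.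
move=> Nx0; apply/eqP; apply: contraT => x0.
have xc0 : x^* != 0.
  apply: contra_neq x0 => xc0; rewrite -(oct_conjK qi x) xc0.
  by rewrite -[0](scale0r 0) oct_conjZ !scale0r.
have /bij_inj inj := (hdiv xc0).1.
by case/eqP: x0; apply: inj; rewrite oct_mul0r (oct_norm_l qi) Nx0 scale0r.
Qed.

(** For [g' <> conj g] take [h = g - conj g']. For [g' = conj g] with
    [g = p + q l], take [h = s l] such that [bar q * s] is skew. *)
Lemma oct_intertwiner g g' :
  T g = T g' -> N g = N g' -> exists2 h, h != 0 & h ** g = g' ** h.
Proof.
move=> eqT eqN; have [E|ne] := eqVneq g g'^*; last first.
  exists (g - g'^*); first by rewrite subr_eq0.
  rewrite (oct_conjE qi) -eqT opprB oct_mulDl oct_mulDr oct_mulDl oct_mulDr.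
  rewrite oct_mulNl oct_mulNr oct_mulZl oct_mulZr oct_mul_1l (oct_mul_1r qi).
  rewrite !(oct_sqr qi) -eqT -eqN [RHS]addrC (addrAC (_ *: g')) subrr add0r.
  by rewrite [LHS]addrC addrA subrK [RHS]addrC.
have {E} -> : g' = g^* by rewrite E (oct_conjK qi).
have [u u0 baru] := qi_skew qi; case: g {eqT eqN} => p q.
pose s := if q == 0 then 1 else q * u.
exists ((0, s) : A).
  suff: s != 0 by apply: contra_neq => -[].
  rewrite /s; have [_|q0] := eqVneq q 0; first exact: oner_neq0.
  apply: contra_neq u0 => qu0.
  have z0 : ((q, 0) : A) != 0 by apply: contra_neq q0 => -[].
  have /bij_inj inj := (hdiv z0).1.
  suff: ((u, 0) : A) = 0 by case.
  apply: inj; rewrite oct_mul0r.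
  by apply: octP; rewrite /= ?qu0 ?linear0 !mul0r ?scaler0 ?mulr0 addr0.
have skew : bar q * s = - (bar s * q).
  rewrite /s; case: eqP => [->|_]; first by rewrite linear0 mul0r mulr0 oppr0.
  rewrite (qi_barM qi) baru mulrA (qi_norm qi) -mulrA (qi_norm qi).
  by rewrite -scalerAl mul1r -scalerAr mulr1 scalerN opprK.
apply: octP => /=; first by rewrite mul0r mulr0 !add0r skew mulrN.
by rewrite linear0 !mulr0 add0r addr0.
Qed.

Lemma conjugateP g g' : conjugate g g' <-> T g = T g' /\ N g = N g'.
Proof.
split=> [[h [h' [hh' h'h <-]]]|[eqT eqN]].
  have NN : N h * N h' = 1.
    by rewrite -(norm_scalarM qi) hh' (norm_scalar1 _ qi).
  have Nh0 : N h != 0.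
    by apply: contra_eq_neq NN => ->; rewrite mul0r eq_sym oner_neq0.
  (* T (h g h') = T (h' (h g)), and h' (h g) = g by the left inverse property *)
  have h'E : N h *: h' = h^* by rewrite -(oct_mulKl qi) hh' (oct_mul_1r qi).
  split; last by rewrite !(norm_scalarM qi) mulrAC NN mul1r.
  rewrite (tr_scalarC qi); congr T; apply: (scalerI Nh0).
  by rewrite -oct_mulZl h'E (oct_mulKl qi).
have [h h0 hg] := oct_intertwiner eqT eqN.
have Nh0 : N h != 0 by apply: contra_neq h0; apply: norm_scalar_eq0.
exists h, ((N h)^-1 *: h^*); split.
- by rewrite oct_mulZr (oct_norm_r qi) scalerA mulVf // scale1r.
- by rewrite oct_mulZl (oct_norm_l qi) scalerA mulVf // scale1r.
- by rewrite oct_mulZr hg (oct_mulKr qi) scalerA mulVf // scale1r.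
Qed.

Lemma oct_expE x k :
  oct_exp x k =
    (pow_coef (T x) (N x) k).1 *: x + (pow_coef (T x) (N x) k).2 *: o1.
Proof.
elim: k => [|k IH]; first by rewrite /= scale0r add0r scale1r.
rewrite [oct_exp _ _]iterS -/(oct_exp x k) IH /= -/(pow_coef _ _ k).
rewrite oct_mulDl !oct_mulZl oct_mul_1l (oct_sqr qi) scalerBr !scalerA.
rewrite scalerDl scaleNr [N x * _]mulrC [T x * _]mulrC.
by rewrite addrAC.
Qed.

(** * Reduction of a polynomial and its companion on a class *)

Section Polynomial.
Variables (n : nat) (c : 'I_n.+1 -> A).

(** The octonions [E] and [G] such that the polynomial with coefficients [c]
    takes the value [E x + G] at every [x] of trace [t] and norm [m]. *)
Definition red_lin (t m : F) : A := \sum_(i < n.+1) (pow_coef t m i).1 *: c i.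
Definition red_cst (t m : F) : A := \sum_(i < n.+1) (pow_coef t m i).2 *: c i.
Local Notation E := red_lin.
Local Notation G := red_cst.

Lemma std_evalE x :
  std_eval c x = E (T x) (N x) ** x + G (T x) (N x).
Proof.
rewrite /std_eval /E /G oct_mul_suml -big_split /=; apply: eq_bigr => i _.
by rewrite oct_expE oct_mulDr !oct_mulZr oct_mulZl (oct_mul_1r qi).
Qed.

Lemma companionE (k : 'I_(2 * n).+1) :
  companion c k =
    \sum_(i < n.+1) \sum_(j < n.+1 | (i + j == k)%N) (c i)^* ** c j.
Proof.
rewrite -sum_antidiagonal; congr (_ + _).
apply: eq_bigr => i _; apply: eq_bigr => j _.
by rewrite /oct_tr (oct_conjM qi) (oct_conjK qi).
Qed.

Lemma sum_companion (f : nat -> F) :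
  \sum_(k < (2 * n).+1) f k *: companion c k =
  \sum_(i < n.+1) \sum_(j < n.+1) f (i + j)%N *: ((c i)^* ** c j).
Proof.
under eq_bigr do rewrite companionE scaler_sumr.
rewrite exchange_big /=; apply: eq_bigr => i _.
under eq_bigr do rewrite scaler_sumr.
rewrite (exchange_big_dep predT) //=; apply: eq_bigr => j _.
have ij : (i + j < (2 * n).+1)%N by rewrite ltnS mul2n -addnn leq_add // -ltnS.
by rewrite (big_pred1 (Ordinal ij)) // => k; rewrite /= -val_eqE eq_sym.
Qed.

Lemma sum_conj_mul (u v : nat -> F) :
  \sum_(i < n.+1) \sum_(j < n.+1) (u i * v j) *: ((c i)^* ** c j) =
  (\sum_(i < n.+1) u i *: c i)^* ** (\sum_(i < n.+1) v i *: c i).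
Proof.
have -> : (\sum_(i < n.+1) u i *: c i)^* = \sum_(i < n.+1) u i *: (c i)^*.
  rewrite (big_morph (fun x : A => x^*) (@oct_conjD _ _ _ _) (id1 := 0)).
    by apply: eq_bigr => i _; rewrite oct_conjZ.
  by rewrite -[0](scale0r 0) oct_conjZ !scale0r.
rewrite oct_mul_suml; apply: eq_bigr => i _.
rewrite oct_mul_sumr; apply: eq_bigr => j _.
by rewrite oct_mulZl oct_mulZr scalerA.
Qed.

Lemma companion_evalE x (e := E (T x) (N x)) (g := G (T x) (N x)) :
  std_eval (companion c) x =
  (T x * N e + T (e^* ** g)) *: x + (N g - N x * N e) *: o1.
Proof.
pose a := fun i => (pow_coef (T x) (N x) i).1.
pose b := fun i => (pow_coef (T x) (N x) i).2.
have -> : std_eval (companion c) x =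
    (\sum_(k < (2 * n).+1) a k *: companion c k) ** x
      + \sum_(k < (2 * n).+1) b k *: companion c k.
  rewrite oct_mul_suml -big_split; apply: eq_bigr => k _ /=.
  by rewrite oct_expE oct_mulDr !oct_mulZr oct_mulZl (oct_mul_1r qi).
have ee : _ = e^* ** e := sum_conj_mul a a.
have eg : _ = e^* ** g := sum_conj_mul a b.
have ge : _ = g^* ** e := sum_conj_mul b a.
have gg : _ = g^* ** g := sum_conj_mul b b.
have -> : \sum_(k < (2 * n).+1) a k *: companion c k =
    (T x * N e + T (e^* ** g)) *: o1.
  rewrite sum_companion scalerDl -scalerA -(oct_norm_l qi) -(oct_trE qi).
  rewrite (oct_conjM qi) (oct_conjK qi) -ee -eg -ge.
  rewrite scaler_sumr -!big_split; apply: eq_bigr => i _ /=.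
  rewrite scaler_sumr -!big_split; apply: eq_bigr => j _ /=.
  rewrite /a pow_coefD /= !scalerDl scalerA mulrA addrA //.
have -> : \sum_(k < (2 * n).+1) b k *: companion c k =
    (N g - N x * N e) *: o1.
  rewrite sum_companion scalerBl -scalerA -!(oct_norm_l qi).
  rewrite -gg -ee scaler_sumr -sumrB; apply: eq_bigr => i _ /=.
  rewrite scaler_sumr -sumrB; apply: eq_bigr => j _ /=.
  by rewrite /b pow_coefD /= scalerBl scalerA mulrA.
by rewrite oct_mulZl oct_mul_1l.
Qed.

(** The roots of the companion polynomial are the elements whose trace and norm
    are those of a root of the polynomial. *)
Lemma companion_root x :
  std_eval (companion c) x = 0 <->
  exists y, [/\ T y = T x, N y = N x & std_eval c y = 0].
Proof.
rewrite companion_evalE; set e := E _ _; set g := G _ _; split; last first.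
  case=> y [eqT eqN]; rewrite std_evalE eqT eqN -/e -/g => /eqP.
  rewrite addrC addr_eq0 => /eqP gE.
  rewrite gE oct_mulNr (oct_mulKl qi) -scaleNr (tr_scalarZ qi) eqT.
  rewrite -scaleN1r (norm_scalarZ qi) (norm_scalarM qi) eqN.
  have -> : T x * N e + - N e * T x = 0 by ring.
  have -> : (-1) ^+ 2 * (N e * N x) - N x * N e = 0 by ring.
  by rewrite !scale0r addr0.
have [e0|e_neq0] := eqVneq e 0.
  have -> : N e = 0.
    by rewrite e0 -[0](scale0r 0) (norm_scalarZ qi) expr0n mul0r.
  have -> : T (e^* ** g) = 0.
    by rewrite e0 -[0](scale0r 0) oct_conjZ oct_mulZl (tr_scalarZ qi) mul0r.
  rewrite !mulr0 addr0 subr0 scale0r add0r -(oct_norm_l qi) => Ng0.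
  have g0 : g = 0.
    apply: norm_scalar_eq0; apply: (@scal_one_inj _ _ bar l2).
    by rewrite -(oct_norm_l qi) Ng0 scale0r.
  by exists x; rewrite std_evalE -/e -/g e0 g0 oct_mul0l addr0.
have [f _ fK] := (hdiv e_neq0).1.
pose m := f (- g); have em : e ** m = - g by rewrite /m fK.
have Ne0 : N e != 0 by apply: contra_neq e_neq0; apply: norm_scalar_eq0.
have gE : g = - (e ** m) by rewrite em opprK.
have -> : T (e^* ** g) = - (N e * T m).
  by rewrite gE oct_mulNr (oct_mulKl qi) -scaleNr (tr_scalarZ qi) mulNr.
have -> : N g = N e * N m.
  rewrite gE -scaleN1r (norm_scalarZ qi) (norm_scalarM qi).
  by rewrite sqrrN expr1n mul1r.
rewrite [T x * _]mulrC [N x * _]mulrC -!mulrBr -!scalerA -scalerDr => /eqP.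
rewrite scaler_eq0 (negPf Ne0) /= => /eqP lin.
suff [eqT eqN] : T m = T x /\ N m = N x.
  by exists m; rewrite std_evalE eqT eqN -/e -/g em addNr.
have [eqT|neT] := eqVneq (T x) (T m).
  split=> //; apply/eqP; rewrite -subr_eq0; apply/eqP.
  apply: (@scal_one_inj _ _ bar l2).
  by move: lin; rewrite eqT subrr scale0r add0r scale0r.
(* Otherwise x is a scalar w, and the relation says that N (w - m) = 0. *)
rewrite -subr_eq0 in neT.
pose w := (N x - N m) / (T x - T m).
have xE : x = w *: o1.
  apply: (scalerI neT); rewrite scalerA mulrC divfK //.
  by apply/eqP; rewrite -subr_eq0 -scaleNr opprB; apply/eqP.
suff -> : m = x by [].
have wE : w * (T x - T m) = N x - N m by rewrite divfK.
have Tx : T x = w * (1 + 1) by rewrite xE (tr_scalarZ qi) (tr_scalar1 _ qi).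
have Nx : N x = w ^+ 2.
  by rewrite xE (norm_scalarZ qi) (norm_scalar1 _ qi) mulr1.
apply/eqP; rewrite -subr_eq0; apply/eqP; apply: norm_scalar_eq0.
rewrite xE -scaleNr (norm_scalarD qi) (norm_scalarZ qi) (norm_scalar1 _ qi).
rewrite oct_mulZr (oct_mul_1r qi) (tr_scalarZ qi) (tr_scalar_conj qi).
rewrite Tx Nx in wE.
have -> : N m + ((- w) ^+ 2 * 1) + (- w * T m) =
          w * (w * (1 + 1) - T m) - (w ^+ 2 - N m) by ring.
by rewrite wE subrr.
Qed.

End Polynomial.
End DivisionOctonions.

Theorem theorem3p4 (F : fieldType) (Q : falgType F) (bar : {linear Q -> Q})
    (hQ : canonical_involution bar) (l2 : F) (hl2 : l2 != 0)
    (hdiv : oct_division bar l2) (n : nat) (c : 'I_n.+1 -> octonion bar l2) :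
  root_set (companion c) = \bigcup_(mu in root_set c) conj_class mu /\
  (forall mu : octonion bar l2, root_set c mu ->
     conj_class mu `<=` root_set c \/
     exists lam : octonion bar l2, conj_class mu `&` root_set c = [set lam]).
Proof.
have [tq [nq qi]] := canonical_involutionP hQ.
have conjP := conjugateP qi hdiv.
split.
  apply/seteqP; split=> [x /(companion_root qi hdiv)[y [eqT eqN y_root]]|].
    by exists y => //; apply/conjP.
  move=> x [y y_root /conjP[eqT eqN]].
  by apply/(companion_root qi hdiv); exists y.
move=> mu mu_root; have evalE := std_evalE qi c.
set t := tr_scalar tq mu; set m := norm_scalar nq mu.
have [e0|e_neq0] := eqVneq (red_lin c t m) 0.
  left=> x /conjP[eqT eqN]; move: mu_root.
  by rewrite /root_set /= !evalE -eqT -eqN -/t -/m e0 !oct_mul0l.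
right; exists mu.
apply/seteqP; split=> [x [/conjP[eqT eqN] x_root]|x ->]; last first.
  by split=> //; apply/conjP.
apply: (bij_inj (hdiv _ e_neq0).1); move: x_root mu_root.
rewrite /root_set /= !evalE -eqT -eqN -/t -/m => /eqP + /eqP.
by rewrite !addr_eq0 => /eqP -> /eqP ->.
Qed.
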